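(* Let $X$ be a real-valued continuous random variable with density $f$ and finite variance, and let $\phi$ be the Gaussian density with the same mean and variance as $f$. Then $$\sigma[X]\leq\sqrt2\,\exp\{D(f\|\phi)\},$$ with equality if and only if $X$ is Gaussian.
   Context: Differential entropy $h$ is assumed to exist and be finite. Doubling constant: $\sigma[X]=\exp\{h(X+X')-h(X)\}$ where $X'$ is an independent copy of $X$. $D(f\|g)=\int f\log(f/g)$ is relative entropy. *)

(* Defs.v *)
From HB Require Import structures.
From mathcomp Require Import all_boot all_order all_algebra.
From mathcomp Require Import all_classical all_reals all_analysis.
Set Implicit Arguments. Unset Strict Implicit. Unset Printing Implicit Defensive.
Import Order.TTheory GRing.Theory Num.Theory Num.Def.
Local Open Scope classical_set_scope.
Local Open Scope ring_scope.

Section defs.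
Context {R : realType}.
Notation mu := (@lebesgue_measure R).

Definition is_density (f : R -> R) : Prop :=
  [/\ forall x, 0 <= f x, measurable_fun setT f &
      (\int[mu]_x (f x)%:E = 1)%E].

(* finite variance (equivalently finite second moment) *)
Definition finite_variance (f : R -> R) : Prop :=
  mu.-integrable setT (fun x => (x ^+ 2 * f x)%:E).

Definition dmean (f : R -> R) : R := Rintegral mu setT (fun x => x * f x).

Definition dvariance (f : R -> R) : R :=
  Rintegral mu setT (fun x => (x - dmean f) ^+ 2 * f x).

(* differential entropy h(f) = - \int f ln f  (with 0 ln 0 = 0) *)
Definition entropy_exists (f : R -> R) : Prop :=
  mu.-integrable setT (fun x => (f x * ln (f x))%:E).

Definition diff_entropy (f : R -> R) : R :=
  - Rintegral mu setT (fun x => f x * ln (f x)).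

(* convolution: density of X + X' for independent X ~ f, X' ~ g *)
Definition dconv (f g : R -> R) (x : R) : R :=
  Rintegral mu setT (fun y => f y * g (x - y)).

(* doubling constant sigma[X] = exp{h(X+X') - h(X)} *)
Definition doubling (f : R -> R) : R :=
  expR (diff_entropy (dconv f f) - diff_entropy f).

Definition rel_entropy (f g : R -> R) : R :=
  Rintegral mu setT (fun x => f x * ln (f x / g x)).

Definition gauss_match (f : R -> R) : R -> R :=
  normal_pdf (dmean f) (Num.sqrt (dvariance f)).

End defs.

(* Main.v *)
(* Write m and v for the mean and variance of f, and g = f * f. Since g has mean
   2m and variance 2v, the right-hand side divided by the left-hand side is
   exp D(g || N(2m, 2v)), so both the inequality and the reduction of its
   equality case to "g is Gaussian" are Gibbs' inequality. If g is Gaussian,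
   the real and imaginary parts C, S of the characteristic function of X - m
   satisfy C^2 - S^2 = c^2 and C S = 0, with c > 0 that of N(0, v); hence S = 0,
   C never vanishes, and C = c by continuity. Injectivity of the Fourier
   transform then gives f = N(m, v). Only real integrals occur. *)
Require Import Defs.
From HB Require Import structures.
From mathcomp Require Import all_boot all_order all_algebra.
From mathcomp Require Import all_classical all_reals all_analysis.
From mathcomp Require Import measurable_realfun ring lra.
Set Implicit Arguments.
Unset Strict Implicit.
Unset Printing Implicit Defensive.
Import Order.TTheory GRing.Theory Num.Theory Num.Def.
Import numFieldNormedType.Exports.
Local Open Scope classical_set_scope.
Local Open Scope ring_scope.

(** * Reflection and translation invariance of Lebesgue measure *)

(** The logarithm of a Gaussian density is quadratic, so a cross-entropy against it depends only on
    a second moment. For [g] against N(2m, 2v) and for [f] against N(m, v) it is 1/2 minus the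
    logarithm of the respective peak; the two peaks differ by the factor sqrt 2, and this is the
    constant of the theorem. The hard direction is to undo a convolution. For two different summands
    this would be Cramer's decomposition theorem; here both summands have the same law, so it
    suffices to extract a square root of a characteristic function, and only a sign remains to be
    fixed. The characteristic function of a Gaussian is never computed. Its positivity comes from
    Gaussian self-convolution, and the Gaussian variance comes from Gibbs' inequality itself.
    Exchanges of integrals are made by Tonelli on nonnegative integrands, which is why cosines and
    sines are integrated in the form 1 + cos and 1 + sin. *)

Section reflection.
Context {R : realType}.
Notation mu := (@lebesgue_measure R).
Local Open Scope ereal_scope.

Lemma measurable_reflect (c : R) :
  measurable_fun [set: measurableTypeR R]
    (fun x : measurableTypeR R => (c - x)%R : measurableTypeR R).
Proof. by apply: measurable_funB. Qed.

(** Lebesgue measure is determined by its values on the intervals []a, b]]. The reflection only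
    changes which end is closed, which leaves the length alone. *)
Lemma lebesgue_measure_reflect (c : R) (A : set (measurableTypeR R)) :
  measurable A ->
  pushforward mu (fun x : measurableTypeR R => (c - x)%R : measurableTypeR R) A = mu A.
Proof.
move=> mA; apply/esym/lebesgue_measure_unique => //.
  exact: measurable_reflect.
move=> mphi _ [[a b]] _ <-.
rewrite /pushforward/=.
rewrite [X in _ = mu X](_ : _ = `[(c - b)%R, (c - a)%R[%classic).
  by rewrite !lebesgue_measure_itv/= !lte_fin ltrD2l ltrN2 -!EFinD; case: ifP => // _;
     congr EFin; ring.
by apply/seteqP; split => x /=; rewrite !in_itv/= => /andP[? ?]; apply/andP; split; lra.
Qed.

Lemma ge0_integral_reflect (c : R) (F : R -> \bar R) : measurable_fun setT F ->
  (forall x, 0 <= F x) -> \int[mu]_x F (c - x)%R = \int[mu]_x F x.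
Proof.
move=> mF F0.
have := @ge0_integral_pushforward _ _ _ _ _ _ (measurable_reflect c) mu setT F.
rewrite preimage_setT => <- //.
apply: eq_measure_integral; first exact: measurable_reflect.
by move=> mphi A mA _; exact: lebesgue_measure_reflect.
Qed.

Lemma integral_reflect (c : R) (F : R -> \bar R) : measurable_fun setT F ->
  \int[mu]_x F (c - x)%R = \int[mu]_x F x.
Proof.
move=> mF; rewrite integralE [RHS]integralE.
rewrite -[X in _ = X - _](ge0_integral_reflect c (measurable_funepos mF))//.
rewrite -[X in _ = _ - X](ge0_integral_reflect c (measurable_funeneg mF)).
  by congr (_ - _); apply: eq_integral => x _; rewrite ?funeposE ?funenegE.
by move=> x; rewrite funenegE le_max lexx orbT.
Qed.

(** A translation is a composite of two reflections: x + c = c - (0 - x). *)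
Lemma integral_shift (c : R) (F : R -> \bar R) : measurable_fun setT F ->
  \int[mu]_x F (x + c)%R = \int[mu]_x F x.
Proof.
move=> mF; rewrite -[RHS](integral_reflect c)//.
rewrite -[RHS](integral_reflect 0); last first.
  by apply: measurableT_comp mF _; exact: measurable_funB.
by apply: eq_integral => x _; congr F; ring.
Qed.

End reflection.

(** * Convolution of densities *)
Section dconv_theory.
Context {R : realType}.
Notation mu := (@lebesgue_measure R).
Local Open Scope ereal_scope.
Variables f g : R -> R.
Hypotheses (df : is_density f) (dg : is_density g).

Let f0 x : (0 <= f x)%R. Proof. by case: df. Qed.
Let g0 x : (0 <= g x)%R. Proof. by case: dg. Qed.
Let mf : measurable_fun setT f. Proof. by case: df. Qed.
Let mg : measurable_fun setT g. Proof. by case: dg. Qed.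
Let f1 : \int[mu]_x (f x)%:E = 1. Proof. by case: df. Qed.
Let g1 : \int[mu]_x (g x)%:E = 1. Proof. by case: dg. Qed.

Let mone : measurable_fun [set: R] (fun=> 1%R : R). Proof. exact: measurable_cst. Qed.

Lemma measurable_dconv_integrand (psi : R -> R) : measurable_fun setT psi ->
  measurable_fun [set: measurableTypeR R * measurableTypeR R]
    (fun z => (f z.2 * g (z.1 - z.2) * psi z.1)%:E).
Proof.
move=> mpsi; apply/measurable_EFinP; apply: measurable_funM; last first.
  by apply: measurableT_comp mpsi _; exact: measurable_fst.
apply: measurable_funM; first by apply: measurableT_comp mf _; exact: measurable_snd.
apply: measurableT_comp mg _; apply: measurable_funB.
- exact: measurable_fst.
- exact: measurable_snd.
Qed.

(** Tonelli followed by the substitution x = y + z in the inner integral. *)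
Lemma integral_dconv_integrand (psi : R -> R) : measurable_fun setT psi ->
  (forall x, 0 <= psi x)%R ->
  \int[mu]_x \int[mu]_y (f y * g (x - y) * psi x)%:E =
  \int[mu]_y \int[mu]_z (f y * g z * psi (y + z))%:E.
Proof.
move=> mpsi psi0.
rewrite (fubini_tonelli _ (measurable_dconv_integrand mpsi))/=; last first.
  by move=> x; rewrite lee_fin !mulr_ge0.
apply: eq_integral => y _.
rewrite -[RHS](integral_shift (- y)); last first.
  apply/measurable_EFinP; apply: measurable_funM; first exact: measurable_funM.
  by apply: measurableT_comp mpsi _; exact: measurable_funD.
by apply: eq_integral => x _; congr (_ * _ * _)%:E; congr psi; ring.
Qed.

(** The convolution with extended values: [dconv f g] is [fine \o k], so it takes the default value
    0 wherever [k] is infinite. *)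
Let k x := \int[mu]_y (f y * g (x - y))%:E.

Let mk : measurable_fun setT k.
Proof.
have mk1 := measurable_dconv_integrand mone.
have := measurable_fun_fubini_tonelli_F (m2 := mu) _ mk1.
move=> /(_ (fun x => _)); rewrite /fubini_F/= => H.
rewrite /k; under eq_fun do under eq_integral do rewrite -[(_ * _)%R]mulr1.
by apply: H => x; rewrite lee_fin !mulr_ge0.
Qed.

Let k0 x : 0 <= k x.
Proof. by apply: integral_ge0 => y _; rewrite lee_fin mulr_ge0. Qed.

Lemma integral_prod_density : \int[mu]_y \int[mu]_z (f y * g z)%:E = 1.
Proof.
rewrite -f1; apply: eq_integral => y _.
under eq_integral do rewrite EFinM.
rewrite ge0_integralZl; [by rewrite g1 mule1|by []|exact/measurable_EFinP| |].
- by move=> x _; rewrite lee_fin.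
- by rewrite lee_fin.
Qed.

Let integral_k : \int[mu]_x k x = 1.
Proof.
transitivity (\int[mu]_x \int[mu]_y (f y * g (x - y) * 1)%:E).
  by apply: eq_integral => x _; apply: eq_integral => y _; rewrite mulr1.
rewrite integral_dconv_integrand// -integral_prod_density.
by apply: eq_integral => y _; apply: eq_integral => z _; rewrite mulr1.
Qed.

(** The extended convolution has integral 1, hence is finite almost everywhere, and there [fine]
    loses nothing. *)
Lemma dconvE : {ae mu, forall x, (dconv f g x)%:E = \int[mu]_y (f y * g (x - y))%:E}.
Proof.
have ik : mu.-integrable setT k.
  apply/integrableP; split => //.
  under eq_integral do rewrite gee0_abs//.
  by rewrite integral_k ltry.
have := integrable_ae measurableT ik; apply: filterS => x /(_ I) kfin.
by rewrite /dconv /Rintegral fineK.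
Qed.

Lemma dconv_ge0 x : (0 <= dconv f g x)%R.
Proof. by apply: Rintegral_ge0 => y _; rewrite mulr_ge0. Qed.

Lemma measurable_dconv : measurable_fun setT (dconv f g).
Proof. by rewrite (_ : dconv f g = fine \o k)//; exact: measurableT_comp. Qed.

Lemma ge0_integral_dconv (psi : R -> R) : measurable_fun setT psi ->
  (forall x, 0 <= psi x)%R ->
  \int[mu]_x (dconv f g x * psi x)%:E =
  \int[mu]_y \int[mu]_z (f y * g z * psi (y + z))%:E.
Proof.
move=> mpsi psi0; rewrite -integral_dconv_integrand//.
transitivity (\int[mu]_x (k x * (psi x)%:E)).
  apply: ae_eq_integral => //.
  - by apply/measurable_EFinP/measurable_funM => //; exact: measurable_dconv.
  - by apply: emeasurable_funM => //; exact/measurable_EFinP.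
  - move: dconvE; apply: filterS; first exact: (ae_filter_ringOfSetsType mu).
    by move=> x kE _; rewrite EFinM kE.
apply: eq_integral => x _.
rewrite /k -ge0_integralZr//.
- apply/measurable_EFinP; apply: measurable_funM => //.
  by apply: measurableT_comp mg _; exact: measurable_funB.
- by move=> y _; rewrite lee_fin mulr_ge0.
- by rewrite lee_fin.
Qed.

Lemma is_density_dconv : is_density (dconv f g).
Proof.
split; [exact: dconv_ge0|exact: measurable_dconv|].
transitivity (\int[mu]_x (dconv f g x * 1)%:E).
  by apply: eq_integral => x _; rewrite mulr1.
rewrite ge0_integral_dconv// -integral_prod_density.
by apply: eq_integral => y _; apply: eq_integral => z _; rewrite mulr1.
Qed.

End dconv_theory.

(** * Expectations under a density *)
Section integrable_real_functions.
Context {R : realType}.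
Notation mu := (@lebesgue_measure R).
Implicit Types F G : R -> R.

Lemma integrableD_EFin F G : mu.-integrable setT (EFin \o F) ->
  mu.-integrable setT (EFin \o G) ->
  mu.-integrable setT (EFin \o (fun x => F x + G x)).
Proof. by move=> iF iG; exact: (integrableD measurableT iF iG). Qed.

Lemma integrableZl_EFin (c : R) F : mu.-integrable setT (EFin \o F) ->
  mu.-integrable setT (EFin \o (fun x => c * F x)).
Proof. by move=> iF; exact: (integrableZl measurableT c iF). Qed.

Lemma integrableB_EFin F G : mu.-integrable setT (EFin \o F) ->
  mu.-integrable setT (EFin \o G) ->
  mu.-integrable setT (EFin \o (fun x => F x - G x)).
Proof. by move=> iF iG; exact: (integrableB measurableT iF iG). Qed.

Lemma EFin_Rintegral F : mu.-integrable setT (EFin \o F) ->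
  (\int[mu]_x (F x)%:E)%E = (Rintegral mu setT F)%:E.
Proof. by move=> iF; rewrite fineK//; exact: (integrable_fin_num measurableT iF). Qed.

Lemma ge0_integrable_Rintegral F (c : R) : measurable_fun setT F ->
  (forall x, 0 <= F x) -> (\int[mu]_x (F x)%:E)%E = c%:E ->
  mu.-integrable setT (EFin \o F) /\ Rintegral mu setT F = c.
Proof.
move=> mF F0 iF; split; last by rewrite /Rintegral iF.
apply/integrableP; split; first exact/measurable_EFinP.
under eq_integral do rewrite /= ger0_norm//.
by rewrite iF ltry.
Qed.

End integrable_real_functions.

Section expectation.
Context {R : realType}.
Notation mu := (@lebesgue_measure R).
Variable f : R -> R.
Implicit Types psi chi : R -> R.

Definition has_expect psi := mu.-integrable setT (EFin \o (fun x => f x * psi x)).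

Definition expect psi : R := \int[mu]_x (f x * psi x).

Lemma eq_expect psi chi : psi =1 chi -> expect psi = expect chi.
Proof. by move=> pc; apply: eq_Rintegral => x _; rewrite pc. Qed.

Lemma eq_has_expect psi chi : psi =1 chi -> has_expect psi -> has_expect chi.
Proof. by move=> pc; apply: eq_integrable => // x _ /=; rewrite pc. Qed.

Lemma has_expectD psi chi : has_expect psi -> has_expect chi ->
  has_expect (fun x => psi x + chi x).
Proof.
move=> hp hc; have := integrableD_EFin hp hc.
by apply: eq_integrable => // x _ /=; rewrite mulrDr.
Qed.

Lemma expectD psi chi : has_expect psi -> has_expect chi ->
  expect (fun x => psi x + chi x) = expect psi + expect chi.
Proof.
move=> hp hc; rewrite /expect -RintegralD//.
by apply: eq_Rintegral => x _; rewrite mulrDr.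
Qed.

Lemma has_expectZ c psi : has_expect psi -> has_expect (fun x => c * psi x).
Proof.
move=> /(integrableZl_EFin c).
by apply: eq_integrable => // x _ /=; rewrite mulrCA.
Qed.

Lemma expectZ c psi : has_expect psi ->
  expect (fun x => c * psi x) = c * expect psi.
Proof.
move=> hp; rewrite /expect -RintegralZl//.
by apply: eq_Rintegral => x _; rewrite mulrCA.
Qed.

Lemma has_expectB psi chi : has_expect psi -> has_expect chi ->
  has_expect (fun x => psi x - chi x).
Proof.
move=> hp /(has_expectZ (-1)) hc.
by apply: eq_has_expect (has_expectD hp hc) => x; rewrite mulN1r.
Qed.

Lemma expectB psi chi : has_expect psi -> has_expect chi ->
  expect (fun x => psi x - chi x) = expect psi - expect chi.
Proof.
move=> hp hc; rewrite -mulN1r -expectZ// -expectD//; last exact: has_expectZ.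
by apply: eq_expect => x; rewrite mulN1r.
Qed.

Hypothesis df : is_density f.

Lemma density_integrable : mu.-integrable setT (EFin \o f).
Proof. by case: df => f0 mf f1; have [] := ge0_integrable_Rintegral mf f0 f1. Qed.

Lemma has_expect_dominated psi chi : measurable_fun setT psi ->
  (forall x, `|psi x| <= `|chi x|) -> has_expect chi -> has_expect psi.
Proof.
case: df => f0 mf _ mpsi pc; apply: le_integrable => //.
  exact/measurable_EFinP/measurable_funM.
by move=> x _ /=; rewrite lee_fin !normrM ler_wpM2l.
Qed.

Lemma has_expect_cst c : has_expect (fun=> c).
Proof.
have := integrableZl_EFin c density_integrable.
by apply: eq_integrable => // x _ /=; rewrite mulrC.
Qed.

Lemma expect_cst c : expect (fun=> c) = c.
Proof.
rewrite /expect RintegralZr//; last exact: density_integrable.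
by case: df => _ _ f1; rewrite /Rintegral f1 mul1r.
Qed.

Lemma has_expect_bounded psi : measurable_fun setT psi ->
  (forall x, `|psi x| <= 1) -> has_expect psi.
Proof.
move=> mpsi p1; apply: has_expect_dominated (has_expect_cst 1) => // x.
by rewrite normr1.
Qed.

Lemma ler_expect psi chi : has_expect psi -> has_expect chi ->
  (forall x, psi x <= chi x) -> expect psi <= expect chi.
Proof.
case: df => f0 _ _ hp hc pc; apply: le_Rintegral => // x _.
by rewrite ler_wpM2l.
Qed.

(* Stated for nonnegative test functions so that Tonelli applies; [K] is the
   conditional expectation of [psi (y + Z)]. *)
Lemma expect_dconv psi K : measurable_fun setT psi -> (forall x, 0 <= psi x) ->
  (forall y, has_expect (fun z => psi (y + z))) ->
  (forall y, expect (fun z => psi (y + z)) = K y) -> has_expect K ->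
  mu.-integrable setT (EFin \o (fun x => dconv f f x * psi x)) /\
  \int[mu]_x (dconv f f x * psi x) = expect K.
Proof.
move=> mpsi psi0 hpsi psiK hK; apply: ge0_integrable_Rintegral.
- by apply: measurable_funM => //; exact: measurable_dconv.
- by move=> x; rewrite mulr_ge0// dconv_ge0.
rewrite ge0_integral_dconv// -EFin_Rintegral//.
apply: eq_integral => y _; rewrite -psiK EFinM -EFin_Rintegral; last exact: hpsi.
rewrite -integralZl//; last exact: hpsi.
by apply: eq_integral => z _; rewrite -EFinM mulrA.
Qed.

End expectation.

(** * Gibbs' inequality against a Gaussian *)
Section gibbs.
Context {R : realType}.
Notation mu := (@lebesgue_measure R).

(** For [a > 0] this is 1 + u <= exp u at u = ln (b / a), multiplied by [a]. *)
Lemma gibbs_pointwise (a b : R) : 0 <= a -> 0 < b ->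
  0 <= a * ln a - a * ln b - a + b.
Proof.
rewrite le_eqVlt => /predU1P[<- b0|a0 b0]; first by rewrite !mul0r subr0 add0r oppr0 add0r ltW.
have := expR_ge1Dx (ln b - ln a).
rewrite -ln_div// lnK ?posrE ?divr_gt0// ln_div// => h.
have : a * (1 + (ln b - ln a)) <= a * (b / a) by rewrite ler_pM2l.
rewrite [X in _ <= X]mulrC divfK ?gt_eqF//; nra.
Qed.

Lemma gibbs_pointwise_eq (a b : R) : 0 <= a -> 0 < b ->
  a * ln a - a * ln b - a + b = 0 -> a = b.
Proof.
rewrite le_eqVlt => /predU1P[<- b0|a0 b0].
  by rewrite !mul0r subr0 add0r oppr0 add0r.
move=> h; have [e|ne] := eqVneq (ln b - ln a) 0.
  have : expR (ln b) = expR (ln a) by congr expR; lra.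
  by rewrite !lnK ?posrE.
have := expR_gt1Dx ne.
rewrite -ln_div// lnK ?posrE ?divr_gt0// ln_div// => h'.
have : a * (1 + (ln b - ln a)) < a * (b / a) by rewrite ltr_pM2l.
rewrite [X in _ < X]mulrC divfK ?gt_eqF//; nra.
Qed.

Lemma normal_pdf_gt0 (m s x : R) : 0 < s -> 0 < normal_pdf m s x.
Proof.
move=> s0; rewrite normal_pdfE ?gt_eqF// mulr_gt0 ?expR_gt0//.
by rewrite normal_peak_gt0// gt_eqF.
Qed.

Lemma ln_normal_pdf (m s x : R) : 0 < s ->
  ln (normal_pdf m s x) = ln (normal_peak s) - (x - m) ^+ 2 / (s ^+ 2 *+ 2).
Proof.
move=> s0; rewrite normal_pdfE ?gt_eqF// lnM ?posrE ?expR_gt0//.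
  by rewrite expRK mulNr.
by rewrite normal_peak_gt0// gt_eqF.
Qed.

Lemma is_density_normal_pdf (m s : R) : is_density (normal_pdf m s).
Proof.
split; [exact: normal_pdf_ge0|exact: measurable_normal_pdf|].
exact: integral_normal_pdf.
Qed.

(** [D] is the relative entropy of [g] with respect to [normal_pdf m s], with the quadratic
    logarithm of the Gaussian expanded. The parameters are not tied to the moments of [g];
    [expect_normal_sqr] exploits this freedom. *)
Lemma gibbs_normal (g : R -> R) (m s : R) : is_density g -> 0 < s ->
  has_expect g (fun x => (x - m) ^+ 2) -> entropy_exists g ->
  let D := expect g (fun x => (x - m) ^+ 2) / (s ^+ 2 *+ 2)
           - ln (normal_peak s) - diff_entropy g in
  0 <= D /\ (D = 0 <-> {ae mu, forall x, g x = normal_pdf m s x}).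
Proof.
move=> dg s0 hv he D.
have [g0 mg g1] := dg.
pose v := s ^+ 2 *+ 2.
(* The last two terms cancel after integration, both densities having mass 1, and they make the
   integrand nonnegative at every point. So [D] vanishes exactly when [d] does almost everywhere. *)
pose d x := g x * ln (g x) - g x * ln (normal_pdf m s x) - g x + normal_pdf m s x.
have d0 x : 0 <= d x by apply: gibbs_pointwise => //; exact: normal_pdf_gt0.
pose A x := g x * ln (g x) + v^-1 * (g x * (x - m) ^+ 2).
pose B x := (1 + ln (normal_peak s)) * g x.
have dE : d =1 (fun x => (A x - B x) + normal_pdf m s x).
  by move=> x; rewrite /d ln_normal_pdf// /A /B /v; ring.
have iA : mu.-integrable setT (EFin \o A).
  by apply: integrableD_EFin => //; exact: integrableZl_EFin.
have iB : mu.-integrable setT (EFin \o B).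
  by apply: integrableZl_EFin; exact: density_integrable.
have iN : mu.-integrable setT (EFin \o normal_pdf m s).
  exact: integrable_normal_pdf.
have iAB := integrableB_EFin iA iB.
have id : mu.-integrable setT (EFin \o d).
  by apply: eq_integrable (integrableD_EFin iAB iN) => // x _ /=; rewrite dE.
have DE : D = Rintegral mu setT d.
  transitivity (\int[mu]_x (A x - B x + normal_pdf m s x)); last first.
    by apply: eq_Rintegral => x _; exact/esym/dE.
  rewrite RintegralD// RintegralB// RintegralD//; last exact: integrableZl_EFin.
  rewrite !RintegralZl//; last exact: density_integrable.
  have -> : \int[mu]_x g x = 1 by rewrite /Rintegral g1.
  have -> : \int[mu]_x normal_pdf m s x = 1.
    by rewrite /Rintegral integral_normal_pdf.
  by rewrite /D /diff_entropy /expect /v; ring.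
split; first by rewrite DE; apply: Rintegral_ge0 => x _; exact: d0.
have md : measurable_fun setT d.
  by apply/measurable_EFinP; exact: (measurable_int _ id).
have absd : (\int[mu]_x `|(d x)%:E| = \int[mu]_x (d x)%:E)%E.
  by apply: eq_integral => x _; rewrite /= ger0_norm.
have [ae1 ae2] := ae_eq_integral_abs mu measurableT
  (measurable_int _ id : measurable_fun setT (EFin \o d)).
split => [D0|gN].
  have /ae1 : (\int[mu]_x `|(EFin \o d) x| = 0)%E.
    by rewrite absd EFin_Rintegral// -DE D0.
  apply: filterS => x /(_ I) /= [dx0].
  by apply: gibbs_pointwise_eq => //; exact: normal_pdf_gt0.
have /ae2 : ae_eq mu setT (EFin \o d) (cst 0%E).
  move: gN; apply: filterS; first exact: (ae_filter_ringOfSetsType mu).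
  by move=> x gx _ /=; rewrite /d gx subrr add0r addNr.
by rewrite absd EFin_Rintegral// -DE => -[].
Qed.

End gibbs.

(** * Gaussian moments and convolution *)
Section normal_moments.
Context {R : realType}.
Notation mu := (@lebesgue_measure R).
Implicit Types m s c x : R.

Lemma normal_peakM c s : 0 < c -> 0 < s -> normal_peak (c * s) = normal_peak s / c.
Proof.
move=> c0 s0; rewrite /normal_peak -invfM; congr (_^-1).
rewrite exprMn -mulrA -mulrnAr sqrtrM ?sqr_ge0// sqrtr_sqr ger0_norm ?ltW//.
exact: mulrC.
Qed.

Lemma normal_pdf_reflect m s x : 0 < s ->
  normal_pdf m s (m *+ 2 - x) = normal_pdf m s x.
Proof.
move=> s0; rewrite !normal_pdfE ?gt_eqF// /normal_fun.
by rewrite (_ : m *+ 2 - x - m = - (x - m)) ?sqrrN//; ring.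
Qed.

(** The reflection of the line in [m] preserves the integral and also changes its sign. *)
Lemma Rintegral_odd_about m (F : R -> R) : mu.-integrable setT (EFin \o F) ->
  (forall x, F (m *+ 2 - x) = - F x) -> Rintegral mu setT F = 0.
Proof.
move=> iF oddF; suff : Rintegral mu setT F = - Rintegral mu setT F by lra.
rewrite -mulN1r -RintegralZl//; congr fine.
rewrite -[LHS](integral_reflect (m *+ 2)); last exact: (measurable_int _ iF).
by apply: eq_integral => x _; rewrite oddF mulN1r.
Qed.

(** Half of the Gaussian exponent absorbs the square: with q = (x - m)^2 / (4 s^2), the bound q
    exp(-q) <= 1 dominates the integrand by a multiple of the Gaussian of doubled variance. *)
Lemma has_expect_normal_sqr m s : 0 < s ->
  has_expect (normal_pdf m s) (fun x => (x - m) ^+ 2).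
Proof.
move=> s0; have s20 : 0 < Num.sqrt 2 * s :> R by rewrite mulr_gt0// sqrtr_gt0.
(* The factor 4 s^2 turns q back into (x - m)^2, and sqrt 2 compensates for the lower peak of the
   wider Gaussian. *)
pose c := s ^+ 2 *+ 4 * Num.sqrt 2.
have := integrableZl_EFin c (integrable_normal_pdf m (Num.sqrt 2 * s)).
apply: le_integrable => //.
  apply/measurable_EFinP/measurable_funM; first exact: measurable_normal_pdf.
  by apply: measurable_funX; exact: measurable_funB.
move=> x _ /=; rewrite lee_fin !ger0_norm; last 2 first.
- rewrite mulr_ge0 ?normal_pdf_ge0// /c mulr_ge0 ?sqrtr_ge0//.
  by rewrite mulrn_wge0 ?sqr_ge0.
- by rewrite mulr_ge0 ?sqr_ge0// normal_pdf_ge0.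
rewrite !normal_pdfE ?gt_eqF// normal_peakM ?sqrtr_gt0// /c /normal_fun.
rewrite exprMn sqr_sqrtr//.
set u := (x - m) ^+ 2; set p := normal_peak s.
have p0 : 0 <= p by exact: normal_peak_ge0.
set q := u / (s ^+ 2 *+ 4).
have sn0 : s != 0 by rewrite gt_eqF.
have -> : - u / (s ^+ 2 *+ 2) = - q - q by rewrite /q; field.
have -> : - u / (2 * s ^+ 2 *+ 2) = - q by rewrite /q; field.
have sqn0 : Num.sqrt 2 != 0 :> R by rewrite gt_eqF// sqrtr_gt0.
have -> : s ^+ 2 *+ 4 * Num.sqrt 2 * (p / Num.sqrt 2 * expR (- q)) =
   p * expR (- q) * (s ^+ 2 *+ 4) by field.
rewrite expRD -!mulrA ler_wpM2l// ler_wpM2l ?expR_ge0//.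
have -> : u = q * (s ^+ 2 *+ 4) by rewrite /q; field.
rewrite mulrA ler_piMl//; first by rewrite mulrn_wge0 ?sqr_ge0.
rewrite expRN mulrC ler_pdivrMr ?expR_gt0// mul1r.
by have := expR_ge1Dx q; lra.
Qed.

Lemma has_expect_normal_centered m s : 0 < s ->
  has_expect (normal_pdf m s) (fun x => x - m).
Proof.
move=> s0; have dN := is_density_normal_pdf m s.
have := has_expectD (has_expect_cst dN 1) (has_expect_normal_sqr m s0).
apply: has_expect_dominated => //; first exact: measurable_funB.
move=> x; move: (x - m) => u.
rewrite [X in _ <= X]ger0_norm ?addr_ge0 ?sqr_ge0// ler_norml.
have := sqr_ge0 (u + 1); have := sqr_ge0 (u - 1); rewrite !expr2 => h1 h2.
by apply/andP; split; nra.
Qed.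

Lemma expect_normal_centered m s : 0 < s ->
  expect (normal_pdf m s) (fun x => x - m) = 0.
Proof.
move=> s0; apply: (@Rintegral_odd_about m) => [|x].
  exact: has_expect_normal_centered.
by rewrite normal_pdf_reflect//; ring.
Qed.

Lemma entropy_exists_normal m s : 0 < s -> entropy_exists (normal_pdf m s).
Proof.
move=> s0; rewrite /entropy_exists.
have h1 := integrableZl_EFin (ln (normal_peak s)) (integrable_normal_pdf m s).
have h2 := integrableZl_EFin (s ^+ 2 *+ 2)^-1 (has_expect_normal_sqr m s0).
apply: eq_integrable (integrableB_EFin h1 h2) => // x _ /=.
by rewrite ln_normal_pdf//; congr EFin; ring.
Qed.

(* Gibbs' inequality against [normal_pdf m (s / c)] gives
   [ln c <= w (c ^+ 2 - 1) / 2] for all [c > 0], where [w] is the variance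
   divided by [s ^+ 2]; both sides vanish at [c = 1], which forces [w = 1]. *)
Lemma expect_normal_sqr m s : 0 < s ->
  expect (normal_pdf m s) (fun x => (x - m) ^+ 2) = s ^+ 2.
Proof.
move=> s0; set W := expect _ _.
have dN := is_density_normal_pdf m s.
have hv := has_expect_normal_sqr m s0; have he := entropy_exists_normal m s0.
(* The equality case for the Gaussian against itself expresses its entropy through [W], so that the
   entropy can be eliminated in [lnc]. *)
have [_ [_ /(_ _)]] := gibbs_normal dN s0 hv he.
rewrite -/W => hN; have {hN} /hN hN : {ae mu, forall x, normal_pdf m s x = normal_pdf m s x}.
  exact: aeW.
pose w := W / s ^+ 2.
have sn0 : s != 0 by rewrite gt_eqF.
(* The logarithm is replaced by its lower bound 1 - 1/c <= ln c, which has the same slope at c = 1,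
   so the test at c = 1 loses nothing. *)
have lnc (c : R) : 0 < c -> (c - 1) / c <= w * (c ^+ 2 - 1) / 2.
  move=> c0; have cn0 : c != 0 by rewrite gt_eqF.
  have c'0 : 0 < c^-1 by rewrite invr_gt0.
  have [+ _] := gibbs_normal dN (mulr_gt0 c'0 s0) hv he.
  rewrite -/W normal_peakM// invrK lnM ?posrE// ?normal_peak_gt0//.
  have -> : W / ((c^-1 * s) ^+ 2 *+ 2) = w * c ^+ 2 / 2.
    by rewrite /w; field; rewrite cn0 sn0.
  have : W / (s ^+ 2 *+ 2) = w / 2 by rewrite /w; field.
  move=> W2; move: hN; rewrite W2 => hN h.
  have : 1 + ln c^-1 <= c^-1.
    by have := expR_ge1Dx (ln c^-1); rewrite lnK ?posrE.
  rewrite lnV ?posrE// => h'.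
  have -> : (c - 1) / c = 1 - c^-1 by field.
  lra.
have w0 : 0 <= w.
  rewrite /w divr_ge0 ?sqr_ge0//; apply: Rintegral_ge0 => x _.
  by rewrite mulr_ge0 ?sqr_ge0 ?normal_pdf_ge0.
suff w1 : w = 1 by move: w1; rewrite /w => /divr1_eq.
apply/eqP; rewrite eq_le; apply/andP; split; rewrite leNgt; apply/negP => hw.
- have w_gt0 : 0 < w by lra.
  (* At c = 1 - e, [lnc] says w (1 - e)(2 - e) / 2 <= 1. Its left side is w - 3we/2 + we^2/2, and
     taking 3we = w - 1 leaves more than (w + 1) / 2 > 1. *)
  pose e := (w - 1) / (3 * w).
  have e0 : 0 < e by apply: divr_gt0; lra.
  have we : w * (3 * e) = w - 1 by rewrite /e; field; rewrite gt_eqF.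
  have e1 : e < 1 by nra.
  have c0 : 0 < 1 - e by lra.
  have := lnc _ c0; rewrite ler_pdivrMr//.
  have -> : 1 - e - 1 = - e by ring.
  have -> : w * ((1 - e) ^+ 2 - 1) / 2 * (1 - e) =
    - e * (w * ((1 - e) * (2 - e)) / 2) by field.
  rewrite -[X in X <= _]mulr1 ler_nM2l ?oppr_lt0//.
  by nra.
(* At c = 1 + e, [lnc] says 1 <= w (1 + e)(2 + e) / 2; with w = 1 - 2e the right side is 1 - e/2 -
   5e^2/2 - e^3 < 1. *)
- pose e := (1 - w) / 2.
  have e0 : 0 < e by rewrite /e; lra.
  have we : w = 1 - 2 * e by rewrite /e; field.
  have c0 : 0 < 1 + e by lra.
  have := lnc _ c0; rewrite ler_pdivrMr//.
  have -> : 1 + e - 1 = e by ring.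
  have -> : w * ((1 + e) ^+ 2 - 1) / 2 * (1 + e) =
    e * (w * ((1 + e) * (2 + e)) / 2) by field.
  rewrite -[X in X <= _]mulr1 ler_pM2l//.
  by nra.
Qed.

(** Completing the square, (y - m)^2 + (x - y - m)^2 = 2 (y - x/2)^2 + (x - 2m)^2 / 2, splits the
    integrand into the claimed density at [x] times a Gaussian density in [y]. *)
Lemma dconv_normal m s : 0 < s ->
  dconv (normal_pdf m s) (normal_pdf m s) = normal_pdf (m *+ 2) (Num.sqrt 2 * s).
Proof.
move=> s0; apply/funext => x; have sn0 : s != 0 by rewrite gt_eqF.
have r0 : 0 < Num.sqrt 2 :> R by rewrite sqrtr_gt0.
have r'0 : 0 < (Num.sqrt 2)^-1 :> R by rewrite invr_gt0.
have r2 : Num.sqrt 2 ^+ 2 = 2 :> R by rewrite sqr_sqrtr.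
transitivity (\int[mu]_y (normal_pdf (m *+ 2) (Num.sqrt 2 * s) x *
                          normal_pdf (x / 2) ((Num.sqrt 2)^-1 * s) y)).
  apply: eq_Rintegral => y _.
  rewrite !normal_pdfE ?mulf_neq0 ?gt_eqF// !normal_peakM// invrK.
  rewrite mulrACA [RHS]mulrACA; congr (_ * _).
    by field; rewrite gt_eqF.
  rewrite /normal_fun -!expRD; congr expR.
  rewrite !exprMn exprVn r2; field; lra.
rewrite RintegralZl//; last exact: integrable_normal_pdf.
by rewrite /Rintegral integral_normal_pdf mulr1.
Qed.

End normal_moments.

(** * Characteristic functions *)
Section characteristic_function.
Context {R : realType}.
Notation mu := (@lebesgue_measure R).
Implicit Types (m s t x : R) (f : R -> R).

(* Real and imaginary parts of the characteristic function of [X - m]. *)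
Definition chf_cos f m t := expect f (fun x => cos (t * (x - m))).
Definition chf_sin f m t := expect f (fun x => sin (t * (x - m))).

Lemma measurable_cosM t m : measurable_fun setT (fun x : R => cos (t * (x - m))).
Proof.
apply: measurableT_comp; first exact: continuous_measurable_fun (@continuous_cos R).
by apply: measurable_funM => //; exact: measurable_funB.
Qed.

Lemma measurable_sinM t m : measurable_fun setT (fun x : R => sin (t * (x - m))).
Proof.
apply: measurableT_comp; first exact: continuous_measurable_fun (@continuous_sin R).
by apply: measurable_funM => //; exact: measurable_funB.
Qed.

Lemma has_expect_cos f m t : is_density f ->
  has_expect f (fun x => cos (t * (x - m))).
Proof.
move=> df; apply: has_expect_bounded => //; first exact: measurable_cosM.
by move=> x; exact: cos_max.
Qed.

Lemma has_expect_sin f m t : is_density f ->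
  has_expect f (fun x => sin (t * (x - m))).
Proof.
move=> df; apply: has_expect_bounded => //; first exact: measurable_sinM.
by move=> x; exact: sin_max.
Qed.

Lemma expect_cos_comb f m t (a b : R) : is_density f ->
  let psi x := a * cos (t * (x - m)) + b * sin (t * (x - m)) in
  has_expect f psi /\ expect f psi = a * chf_cos f m t + b * chf_sin f m t.
Proof.
move=> df psi; have hc := has_expect_cos m t df; have hs := has_expect_sin m t df.
split; first by apply: has_expectD; exact: has_expectZ.
by rewrite /psi expectD ?expectZ//; exact: has_expectZ.
Qed.

(** The real part of the square of the characteristic function, by the addition formula for cos. The
    added 1 gives [expect_dconv] a nonnegative test function and cancels at the end. *)
Lemma chf_cos_dconv f m t : is_density f ->
  chf_cos (dconv f f) (m *+ 2) t = chf_cos f m t ^+ 2 - chf_sin f m t ^+ 2.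
Proof.
move=> df; have dg := is_density_dconv df df.
pose C := chf_cos f m t; pose S := chf_sin f m t.
pose k y x := 1 + (cos (t * (y - m)) * cos (t * (x - m)) +
                   - sin (t * (y - m)) * sin (t * (x - m))).
have kE y z : 1 + cos (t * (y + z - m *+ 2)) = k y z.
  rewrite /k (_ : t * (y + z - m *+ 2) = t * (y - m) + t * (z - m)).
    by rewrite cosD mulNr.
  by ring.
have hk y : has_expect f (k y) /\ expect f (k y) =
    1 + (cos (t * (y - m)) * C + - sin (t * (y - m)) * S).
  have [h e] := expect_cos_comb m t (cos (t * (y - m))) (- sin (t * (y - m))) df.
  split; first by apply: has_expectD h; exact: has_expect_cst.
  by rewrite expectD ?expect_cst ?e//; exact: has_expect_cst.
pose K y := 1 + (C * cos (t * (y - m)) + - S * sin (t * (y - m))).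
have [hK eK] : has_expect f K /\ expect f K = 1 + (C * C + - S * S).
  have [h e] := expect_cos_comb m t C (- S) df.
  split; first by apply: has_expectD h; exact: has_expect_cst.
  by rewrite expectD ?expect_cst ?e//; exact: has_expect_cst.
have [||||_] := @expect_dconv _ f df (fun x => 1 + cos (t * (x - m *+ 2))) K _ _ _ _ hK.
- by apply: measurable_funD => //; exact: measurable_cosM.
- by move=> x; have := cos_geN1 (t * (x - m *+ 2)); lra.
- by move=> y; apply: eq_has_expect (hk y).1 => z; rewrite kE.
- move=> y; rewrite (eq_expect _ (kE y)) (hk y).2 /K; ring.
rewrite eK -/(expect (dconv f f) _) expectD; first last.
- exact: has_expect_cos.
- exact: has_expect_cst.
by rewrite expect_cst// -/(chf_cos _ _ _) -/C -/S; lra.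
Qed.

Lemma chf_sin_dconv f m t : is_density f ->
  chf_sin (dconv f f) (m *+ 2) t = chf_sin f m t * chf_cos f m t *+ 2.
Proof.
move=> df; have dg := is_density_dconv df df.
pose C := chf_cos f m t; pose S := chf_sin f m t.
pose k y x := 1 + (sin (t * (y - m)) * cos (t * (x - m)) +
                   cos (t * (y - m)) * sin (t * (x - m))).
have kE y z : 1 + sin (t * (y + z - m *+ 2)) = k y z.
  rewrite /k (_ : t * (y + z - m *+ 2) = t * (y - m) + t * (z - m)).
    by rewrite sinD.
  by ring.
have hk y : has_expect f (k y) /\ expect f (k y) =
    1 + (sin (t * (y - m)) * C + cos (t * (y - m)) * S).
  have [h e] := expect_cos_comb m t (sin (t * (y - m))) (cos (t * (y - m))) df.
  split; first by apply: has_expectD h; exact: has_expect_cst.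
  by rewrite expectD ?expect_cst ?e//; exact: has_expect_cst.
pose K y := 1 + (S * cos (t * (y - m)) + C * sin (t * (y - m))).
have [hK eK] : has_expect f K /\ expect f K = 1 + (S * C + C * S).
  have [h e] := expect_cos_comb m t S C df.
  split; first by apply: has_expectD h; exact: has_expect_cst.
  by rewrite expectD ?expect_cst ?e//; exact: has_expect_cst.
have [||||_] := @expect_dconv _ f df (fun x => 1 + sin (t * (x - m *+ 2))) K _ _ _ _ hK.
- by apply: measurable_funD => //; exact: measurable_sinM.
- by move=> x; have := sin_geN1 (t * (x - m *+ 2)); lra.
- by move=> y; apply: eq_has_expect (hk y).1 => z; rewrite kE.
- move=> y; rewrite (eq_expect _ (kE y)) (hk y).2 /K; ring.
rewrite eK -/(expect (dconv f f) _) expectD; first last.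
- exact: has_expect_sin.
- exact: has_expect_cst.
by rewrite expect_cst// -/(chf_sin _ _ _) -/C -/S; lra.
Qed.

Lemma chf_cos0 f m : is_density f -> chf_cos f m 0 = 1.
Proof.
move=> df; rewrite -[RHS](expect_cst df 1); apply: eq_expect => x.
by rewrite mul0r cos0.
Qed.

Lemma chf_cosN f m t : chf_cos f m (- t) = chf_cos f m t.
Proof. by apply: eq_expect => x; rewrite mulNr cosN. Qed.

Lemma continuous_chf_cos f m : is_density f -> continuous (chf_cos f m).
Proof.
move=> df t; have [f0 mf _] := df.
apply: (@continuity_under_integral R _ _ mu
  (fun t x => f x * cos (t * (x - m))) setT measurableT (t - 1) (t + 1) _ _ f) => //=.
- by move=> u _; exact: has_expect_cos.
- apply: aeW => y _ u _; apply: continuousM; first exact: cst_continuous.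
  apply: continuous_comp; last exact: continuous_cos.
  by apply: continuousM => //; exact: cst_continuous.
- exact: density_integrable.
- move=> u _; apply: aeW => y _; rewrite normrM ger0_norm// ler_piMr//.
  exact: cos_max.
- by rewrite inE/= in_itv/=; apply/andP; split; lra.
Qed.

Lemma sin_sqr_le x : sin x ^+ 2 <= x ^+ 2.
Proof.
wlog x0 : x / 0 <= x.
  move=> h; have [/h//|x0] := leP 0 x.
  by rewrite -(sqrrN (sin x)) -(sqrrN x) -sinN; apply: h; lra.
have [|c _] := @MVT_segment R sin cos 0 x x0.
  by apply: continuous_subspaceT; exact: continuous_sin.
by rewrite sin0 !subr0 => ->; rewrite exprMn ler_piMl ?sqr_ge0.
Qed.

(** Half-angle formula: 1 - cos x = 2 sin^2 (x/2) <= x^2 / 2. *)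
Lemma cos_ge_quadratic x : 1 - x ^+ 2 / 2 <= cos x.
Proof.
have := sin_sqr_le (x / 2); rewrite sin2cos2.
have -> : cos x = cos (x / 2) ^+ 2 *+ 2 - 1 by rewrite -cos_mulr2n; congr cos; field.
by rewrite exprMn exprVn; lra.
Qed.

Lemma chf_sin_normal m s t : 0 < s -> chf_sin (normal_pdf m s) m t = 0.
Proof.
move=> s0; apply: (@Rintegral_odd_about _ m) => [|x].
  exact: (has_expect_sin m t (is_density_normal_pdf m s)).
rewrite normal_pdf_reflect// (_ : t * (m *+ 2 - x - m) = - (t * (x - m))).
  by rewrite sinN mulrN.
by ring.
Qed.

(* Halving the variance takes a square root of the characteristic function,
   and for small variance [cos u >= 1 - u ^+ 2 / 2] bounds it away from [0]. *)
Lemma chf_cos_normal_gt0 m s t : 0 < s -> 0 < chf_cos (normal_pdf m s) m t.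
Proof.
(* [n] counts the halvings of the variance after which t^2 s^2 / 2^n < 2, so that the quadratic
   lower bound has positive expectation. *)
move=> s0; have [n hn] : exists n, t ^+ 2 * s ^+ 2 < 2 * 2 ^+ n.
  exists (truncn (t ^+ 2 * s ^+ 2)).+1.
  have h := truncnS_gt (t ^+ 2 * s ^+ 2).
  apply: (lt_trans h); rewrite -natrX -natrM ltr_nat.
  by rewrite -expnS (leq_trans (ltn_expl _ (isT : 1 < 2)%N))// leq_exp2l.
elim: n m s s0 hn => [|n IH] m s s0 hn.
  have dN := is_density_normal_pdf m s.
  have hq : has_expect (normal_pdf m s) (fun x => t ^+ 2 / 2 * (x - m) ^+ 2).
    exact/has_expectZ/has_expect_normal_sqr.
  have := ler_expect dN (has_expectB (has_expect_cst dN 1) hq) (has_expect_cos m t dN).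
  rewrite expectB ?expect_cst//; last exact: has_expect_cst.
  rewrite expectZ; last exact: has_expect_normal_sqr.
  rewrite expect_normal_sqr// => /(_ _) h.
  have : 1 - t ^+ 2 / 2 * s ^+ 2 <= chf_cos (normal_pdf m s) m t.
    apply: h => x; have := cos_ge_quadratic (t * (x - m)).
    by rewrite exprMn; lra.
  by move: hn; rewrite expr0; lra.
have r0 : 0 < Num.sqrt 2 :> R by rewrite sqrtr_gt0.
have s'0 : 0 < s / Num.sqrt 2 by rewrite divr_gt0.
have dN := is_density_normal_pdf (m / 2) (s / Num.sqrt 2).
have := chf_cos_dconv (m / 2) t dN.
rewrite dconv_normal// chf_sin_normal// expr0n subr0.
have -> : m / 2 *+ 2 = m by field.
have -> : Num.sqrt 2 * (s / Num.sqrt 2) = s by field; rewrite gt_eqF.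
move=> ->.
rewrite exprn_gt0// IH// exprMn exprVn sqr_sqrtr//.
by move: hn; rewrite (exprS 2 n); lra.
Qed.

Lemma ae_eq_expect f g psi : measurable_fun setT f -> measurable_fun setT g ->
  measurable_fun setT psi -> {ae mu, forall x, f x = g x} ->
  expect f psi = expect g psi.
Proof.
move=> mf mg mpsi fg; congr fine; apply: ae_eq_integral => //.
- exact/measurable_EFinP/measurable_funM.
- exact/measurable_EFinP/measurable_funM.
- move: fg; apply: filterS; first exact: (ae_filter_ringOfSetsType mu).
  by move=> x -> _.
Qed.

Lemma chf_of_normal_dconv f m s : is_density f -> 0 < s ->
  {ae mu, forall x, dconv f f x = normal_pdf (m *+ 2) (Num.sqrt 2 * s) x} ->
  forall t, chf_cos f m t = chf_cos (normal_pdf m s) m t /\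
            chf_sin f m t = chf_sin (normal_pdf m s) m t.
Proof.
move=> df s0 gN; have dN := is_density_normal_pdf m s.
have [_ mg _] := is_density_dconv df df.
have sqC t : chf_cos f m t ^+ 2 - chf_sin f m t ^+ 2 =
             chf_cos (normal_pdf m s) m t ^+ 2.
  have := chf_cos_dconv m t dN; rewrite chf_sin_normal// expr0n subr0 => <-.
  rewrite dconv_normal// -chf_cos_dconv//; apply: ae_eq_expect => //.
  - exact: measurable_normal_pdf.
  - exact: measurable_cosM.
have prodCS t : chf_sin f m t * chf_cos f m t = 0.
  have := chf_sin_dconv m t dN; rewrite chf_sin_normal// mul0r mul0rn dconv_normal//.
  move=> h; suff : chf_sin f m t * chf_cos f m t *+ 2 = 0.
    by move=> /eqP; rewrite mulrn_eq0/= => /eqP.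
  rewrite -chf_sin_dconv// -h; apply: ae_eq_expect => //.
  - exact: measurable_normal_pdf.
  - exact: measurable_sinM.
(* At a zero of the real part, [sqC] would equate minus a square with a positive number. *)
have Cn0 t : chf_cos f m t != 0.
  apply/eqP => C0; have := sqC t; rewrite C0 expr0n sub0r.
  have := exprn_gt0 2 (chf_cos_normal_gt0 m t s0).
  by have := sqr_ge0 (chf_sin f m t); lra.
have S0 t : chf_sin f m t = 0.
  by have /eqP := prodCS t; rewrite mulf_eq0 (negbTE (Cn0 t)) orbF => /eqP.
have Cgt0 t : 0 < chf_cos f m t.
  wlog t0 : t / 0 <= t.
    move=> h; have [/h//|t0] := leP 0 t.
    by rewrite -chf_cosN; apply: h; lra.
  rewrite lt_neqAle eq_sym Cn0/= leNgt; apply/negP => Ct.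
  have [||c _ c0] := @IVT R (chf_cos f m) 0 t 0 t0.
  - by apply: continuous_subspaceT; exact: continuous_chf_cos.
  - by rewrite chf_cos0// ge_min le_max ler01 (ltW Ct) orbT.
  - by have := Cn0 c; rewrite c0 eqxx.
move=> t; rewrite S0 chf_sin_normal//; split => //.
have := sqC t; rewrite S0 expr0n subr0 => /eqP.
by rewrite eqrXn2// ?ltW ?chf_cos_normal_gt0// => /eqP.
Qed.

End characteristic_function.

(** * Laplace and Cauchy kernels *)
Section kernels.
Context {R : realType}.
Notation mu := (@lebesgue_measure R).

Lemma is_derive_comp_mulr (g : R -> R) (c t dg : R) :
  is_derive (c * t) 1 g dg -> is_derive t 1 (fun t => g (c * t)) (c * dg).
Proof.
move=> hg; have hc : is_derive t 1 (fun t => c * t) c.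
  by apply: is_derive_eq; rewrite /GRing.scale/= mulr1.
have := @is_derive1_comp R g (fun t => c * t) t dg c hg hc.
by move=> h; apply: is_derive_eq h _; rewrite mulrC.
Qed.

Section laplace.
Variables e z : R.
Hypothesis e0 : 0 < e.

(** [F] is the antiderivative of [f] found by integrating exp(-et) and the real part of exp((-e +
    iz)t). As [B] is bounded, [F] tends to 0 at infinity. *)
Let B t := e^-1 + (e * cos (z * t) - z * sin (z * t)) / (e ^+ 2 + z ^+ 2).
Let F t := - (expR (- e * t) * B t).
Let f t := expR (- e * t) * (1 + cos (z * t)).

Let dF (t : R) : is_derive t 1 F (f t).
Proof.
have h1 : is_derive t 1 (fun t => expR (- e * t)) (- e * expR (- e * t)).
  exact: is_derive_comp_mulr.
have h2 : is_derive t 1 (fun t => cos (z * t)) (z * - sin (z * t)).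
  exact: is_derive_comp_mulr.
have h3 : is_derive t 1 (fun t => sin (z * t)) (z * cos (z * t)).
  exact: is_derive_comp_mulr.
have h4 : is_derive t 1 B
  ((e * (z * - sin (z * t)) - z * (z * cos (z * t))) / (e ^+ 2 + z ^+ 2)).
  rewrite /B; apply: is_derive_eq; rewrite /GRing.scale/=; ring.
rewrite /F; apply: is_derive_eq; rewrite /GRing.scale/= /f /B; field.
have q0 : 0 < e ^+ 2 + z ^+ 2 by rewrite ltr_wpDr ?sqr_ge0// exprn_gt0.
by rewrite (gt_eqF e0) (gt_eqF q0).
Qed.

Let continuousF : continuous F.
Proof. by move=> t; apply/differentiable_continuous/derivable1_diffP; have [] := dF t. Qed.

Let continuousf : continuous f.
Proof.
move=> t; have h1 : is_derive t 1 (fun t => expR (- e * t)) (- e * expR (- e * t)).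
  exact: is_derive_comp_mulr.
have h2 : is_derive t 1 (fun t => cos (z * t)) (z * - sin (z * t)).
  exact: is_derive_comp_mulr.
by apply/differentiable_continuous/derivable1_diffP; exact: ex_derive.
Qed.

(** The term e / (e^2 + z^2) is, up to the factor pi, the Poisson kernel of width [e]; [e^-1] is the
    contribution of the 1 that keeps the integrand nonnegative. *)
Lemma laplace_one_plus_cos :
  (\int[mu]_(t in `[0%R, +oo[) (expR (- e * t) * (1 + cos (z * t)))%:E =
   (e^-1 + e / (e ^+ 2 + z ^+ 2))%:E)%E.
Proof.
have F0 : F 0 = - (e^-1 + e / (e ^+ 2 + z ^+ 2)).
  by rewrite /F /B !mulr0 expR0 cos0 sin0 !mulr0 subr0 mulr1 mul1r.
have -> : ((e^-1 + e / (e ^+ 2 + z ^+ 2))%:E = 0%:E - (F 0)%:E)%E.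
  by rewrite F0 -EFinB sub0r opprK.
apply: (@ge0_continuous_FTC2y R f F 0 0).
- move=> t _; apply: mulr_ge0; first exact: expR_ge0.
  by have := cos_geN1 (z * t); lra.
- by apply: continuous_subspaceT; exact: continuousf.
- pose M := e^-1 + (e + `|z|) / (e ^+ 2 + z ^+ 2).
  have q0 : 0 < e ^+ 2 + z ^+ 2 by rewrite ltr_wpDr ?sqr_ge0// exprn_gt0.
  have BM t : `|B t| <= M.
    apply: (le_trans (ler_normD _ _)); rewrite (_ : `|e^-1| = e^-1); last by rewrite gtr0_norm ?invr_gt0.
    rewrite /M lerD2l normrM [X in _ * X]ger0_norm ?invr_ge0 ?(ltW q0)//.
    rewrite ler_wpM2r ?invr_ge0 ?(ltW q0)//.
    apply: (le_trans (ler_normB _ _)); rewrite !normrM (gtr0_norm e0).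
    by apply: lerD; apply: ler_piMr => //; [exact: ltW|exact: cos_max|exact: sin_max].
  have cE : expR (- e * t) @[t --> +oo] --> (0 : R).
    rewrite (_ : (fun x => expR (- e * x)) =
                 (fun z => expR (- z)) \o (fun z => e * z)); last first.
      by apply: eq_fun => x; rewrite mulNr.
    apply: (@cvg_comp _ _ _ _ _ _ (pinfty_nbhs R)); last exact: cvgr_expR.
    exact: gt0_cvgMry.
  apply/norm_cvg0P.
  apply: (@squeeze_cvgr _ _ _ _ (fun=> 0) (fun t => M * expR (- e * t))).
  + apply: nearW => t /=; rewrite normr_ge0/= /F normrN normrM.
    by rewrite [`|expR _|]ger0_norm ?expR_ge0// [leRHS]mulrC ler_wpM2l ?expR_ge0.
  + exact: cvg_cst.
  + by rewrite -[X in _ --> X](mulr0 M); apply: cvgM cE; exact: cvg_cst.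
- by move=> t _; have [] := dF t.
- by apply: cvg_at_right_filter; exact: continuousF.
- by move=> t _; rewrite derive1E; have [_ ->] := dF t.
Qed.

End laplace.

Lemma integral_cauchy_kernel (e x a b : R) : 0 < e -> a < b ->
  (\int[mu]_(y in `[a, b]) (e / (e ^+ 2 + (x - y) ^+ 2))%:E =
   (atan (e^-1 * (b - x)) - atan (e^-1 * (a - x)))%:E)%E.
Proof.
move=> e0 ab; pose F y := atan (e^-1 * (y - x)).
have q0 y : 0 < e ^+ 2 + (x - y) ^+ 2 by rewrite ltr_wpDr ?sqr_ge0// exprn_gt0.
have dF (y : R) : is_derive y 1 F (e / (e ^+ 2 + (x - y) ^+ 2)).
  have hc : is_derive y 1 (fun y => e^-1 * (y - x)) e^-1.
    by apply: is_derive_eq; rewrite /GRing.scale/= subr0 mulr1.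
  have := @is_derive1_comp R atan (fun y => e^-1 * (y - x)) y _ _ (is_derive1_atan _) hc.
  move=> h; apply: is_derive_eq h _; field.
  by rewrite (gt_eqF e0) (gt_eqF (q0 y)).
rewrite (@continuous_FTC2 R _ F a b ab).
- by [].
- apply: continuous_subspaceT => y.
  have qn0 : e ^+ 2 + (x - y) ^+ 2 != 0 by rewrite gt_eqF.
  by apply/differentiable_continuous/derivable1_diffP; exact: ex_derive.
- have cF : continuous F.
    by move=> y; apply/differentiable_continuous/derivable1_diffP; have [] := dF y.
  split; first by move=> y _; have [] := dF y.
  + by apply: cvg_at_right_filter; exact: cF.
  + by apply: cvg_at_left_filter; exact: cF.
- by move=> y _; rewrite derive1E; have [_ ->] := dF y.
Qed.

End kernels.

(** * Fourier uniqueness *)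
Section fourier_uniqueness.
Context {R : realType}.
Notation mu := (@lebesgue_measure R).
Implicit Types (f g K : R -> R) (D : set R).

Lemma integral_mixtureE f D (k : R * R -> R) K : is_density f -> measurable D ->
  measurable_fun [set: measurableTypeR R * measurableTypeR R] k ->
  (forall z, 0 <= k z) ->
  (forall x, \int[mu]_(t in D) (k (x, t))%:E = (K x)%:E)%E ->
  (\int[mu]_x (f x * K x)%:E =
   \int[mu]_t \int[mu]_x (f x * k (x, t) * \1_D t)%:E)%E.
Proof.
move=> [f0 mf _] mD mk k0 kK.
have mD1 : measurable_fun [set: R] (\1_D : R -> R) by exact: measurable_indic.
pose k' (z : measurableTypeR R * measurableTypeR R) := (f z.1 * k z * \1_D z.2)%:E.
have mk' : measurable_fun setT k'.
  apply/measurable_EFinP; apply: measurable_funM; last first.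
    by apply: measurableT_comp mD1 _; exact: measurable_snd.
  apply: measurable_funM => //.
  by apply: measurableT_comp mf _; exact: measurable_fst.
have k'0 z : (0 <= k' z)%E by rewrite lee_fin !mulr_ge0.
have /= <- := @fubini_tonelli _ _ _ _ _ mu mu k' mk' k'0.
apply: eq_integral => x _; rewrite EFinM -kK integral_mkcond.
have mkx : measurable_fun setT (fun t : R => k (x, t)).
  by apply: (measurableT_comp mk); exact: measurable_pair1.
rewrite -ge0_integralZl//.
- apply: eq_integral => t _; rewrite /k'/= patchE indicE.
  by case: (t \in D); rewrite ?mulr1 ?mulr0 ?mule0 ?EFinM.
- apply/(measurable_restrictT _ _).1 => //.
  by apply/measurable_EFinP; exact: measurable_funTS.
- by move=> t _; apply: erestrict_ge0 => u _; rewrite lee_fin.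
- by rewrite lee_fin.
Qed.

(** By Tonelli, equality of expectations passes from the kernels [k (_, t)] to their integral over
    [t] in [D]. It serves twice: for the Laplace transform over a half-line, and for the Poisson
    kernel integrated over its centre. *)
Lemma eq_integral_mixture f g D (k : R * R -> R) K : is_density f -> is_density g ->
  measurable D -> measurable_fun [set: measurableTypeR R * measurableTypeR R] k ->
  (forall z, 0 <= k z) ->
  (forall x, \int[mu]_(t in D) (k (x, t))%:E = (K x)%:E)%E ->
  (forall t, D t -> \int[mu]_x (f x * k (x, t))%:E =
                    \int[mu]_x (g x * k (x, t))%:E)%E ->
  expect f K = expect g K.
Proof.
move=> df dg mD mk k0 kK fgk; congr fine.
rewrite (integral_mixtureE df mD mk k0 kK) (integral_mixtureE dg mD mk k0 kK).
apply: eq_integral => t _; rewrite indicE; have [/set_mem Dt|_] := boolP (t \in D).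
  under eq_integral do rewrite mulr1; under [RHS]eq_integral do rewrite mulr1.
  exact: fgk.
by under eq_integral do rewrite mulr0; under [RHS]eq_integral do rewrite mulr0.
Qed.

Lemma expect_cvg f (u : nat -> R -> R) K (M : R) : is_density f ->
  (forall n, measurable_fun setT (u n)) ->
  (forall n x, `|u n x| <= M) -> (forall x, u n x @[n --> \oo] --> K x) ->
  expect f (u n) @[n --> \oo] --> expect f K.
Proof.
move=> df mu_ uM uK; have [f0 mf _] := df.
have mK : measurable_fun setT K by exact: measurable_fun_cvg (fun x _ => uK x).
have iM := integrableZl_EFin M (density_integrable df).
have [] := @dominated_convergence _ _ _ mu setT measurableT
  (fun n x => (f x * u n x)%:E) (fun x => (f x * K x)%:E) (fun x => (M * f x)%:E).
- by move=> n; apply/measurable_EFinP; apply: measurable_funM => //; exact: mu_.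
- by apply/measurable_EFinP; apply: measurable_funM => //; exact: mK.
- apply: aeW => x _; apply: cvg_EFin; first exact: nearW.
  by apply: cvgM; [exact: cvg_cst|exact: uK].
- exact: iM.
- apply: aeW => x n _ /=; rewrite lee_fin normrM (ger0_norm (f0 x)) mulrC.
  by rewrite ler_wpM2r.
- move=> iK _ cK; apply: fine_cvg; rewrite fineK; first exact: cK.
  exact: integrable_fin_num.
Qed.

End fourier_uniqueness.

Section fourier_uniqueness.
Context {R : realType}.
Notation mu := (@lebesgue_measure R).
Variables (f g : R -> R) (m : R).
Hypotheses (df : is_density f) (dg : is_density g).
Hypothesis eq_cos : forall t, chf_cos f m t = chf_cos g m t.
Hypothesis eq_sin : forall t, chf_sin f m t = chf_sin g m t.

(** Moving the centre from [m] to [y] rotates the pair of real and imaginary parts, so the new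
    cosine part needs both old ones. *)
Let eq_chf_cos y t : chf_cos f y t = chf_cos g y t.
Proof.
pose psi x := cos (t * (m - y)) * cos (t * (x - m)) +
              - sin (t * (m - y)) * sin (t * (x - m)).
have psiE x : cos (t * (x - y)) = psi x.
  rewrite /psi (_ : t * (x - y) = t * (m - y) + t * (x - m)); last by ring.
  by rewrite cosD mulNr.
rewrite /chf_cos !(eq_expect _ psiE).
rewrite (expect_cos_comb m t _ _ df).2 (expect_cos_comb m t _ _ dg).2.
by rewrite eq_cos eq_sin.
Qed.

Lemma measurable_cauchy_kernel (d : measure_display) (T : measurableType d)
    (e : R) (u : T -> R) : 0 < e -> measurable_fun setT u ->
  measurable_fun setT (fun x => e / (e ^+ 2 + u x ^+ 2)).
Proof.
move=> e0 mu_; have mV : measurable_fun [set: R] (fun x : R => (e ^+ 2 + x ^+ 2)^-1).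
  apply: continuous_measurable_fun => x.
  have qn0 : e ^+ 2 + x ^+ 2 != 0 by rewrite gt_eqF// ltr_wpDr ?sqr_ge0// exprn_gt0.
  by apply/differentiable_continuous/derivable1_diffP; exact: ex_derive.
by apply: measurable_funM => //; exact: (measurableT_comp mV).
Qed.

Lemma cauchy_kernel_bounds (e x y : R) : 0 < e ->
  0 <= e / (e ^+ 2 + (x - y) ^+ 2) <= e^-1.
Proof.
move=> e0; have q0 : 0 < e ^+ 2 + (x - y) ^+ 2.
  by rewrite ltr_wpDr ?sqr_ge0// exprn_gt0.
rewrite (divr_ge0 (ltW e0) (ltW q0))/= ler_pdivrMr//.
have -> : e^-1 * (e ^+ 2 + (x - y) ^+ 2) = e + e^-1 * (x - y) ^+ 2.
  by field; rewrite gt_eqF.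
by rewrite lerDl mulr_ge0 ?sqr_ge0// invr_ge0 ltW.
Qed.

Lemma has_expect_cauchy (h : R -> R) (e y : R) : is_density h -> 0 < e ->
  has_expect h (fun x => e / (e ^+ 2 + (x - y) ^+ 2)).
Proof.
move=> dh e0; apply: has_expect_dominated (has_expect_cst dh e^-1) => //.
  by apply: measurable_cauchy_kernel => //; exact: measurable_funB.
move=> x; have /andP[h1 h2] := cauchy_kernel_bounds x y e0.
by rewrite !ger0_norm// invr_ge0 ltW.
Qed.

Let expect_cauchy (e y : R) : 0 < e ->
  expect f (fun x => e / (e ^+ 2 + (x - y) ^+ 2)) =
  expect g (fun x => e / (e ^+ 2 + (x - y) ^+ 2)).
Proof.
move=> e0; pose k (z : R * R) := expR (- e * z.2) * (1 + cos ((z.1 - y) * z.2)).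
have kt t x : k (x, t) = expR (- e * t) * (1 + cos (t * (x - y))).
  by rewrite /k/= [t * _]mulrC.
have hk h t : is_density h -> has_expect h (fun x => k (x, t)) /\
    expect h (fun x => k (x, t)) = expR (- e * t) * (1 + chf_cos h y t).
  move=> dh; have h1 := has_expectD (has_expect_cst dh 1) (has_expect_cos y t dh).
  split; first by apply: eq_has_expect (has_expectZ _ h1) => x; rewrite kt.
  rewrite (eq_expect _ (kt t)) expectZ// expectD ?expect_cst//.
  - exact: has_expect_cst.
  - exact: has_expect_cos.
have : expect f (fun x => e^-1 + e / (e ^+ 2 + (x - y) ^+ 2)) =
       expect g (fun x => e^-1 + e / (e ^+ 2 + (x - y) ^+ 2)).
  apply: (@eq_integral_mixture _ f g `[0, +oo[%classic k) => //.
  - apply: measurable_funM.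
      apply: measurableT_comp; first exact: continuous_measurable_fun (@continuous_expR R).
      by apply: measurable_funM => //; exact: measurable_snd.
    apply: measurable_funD => //.
    apply: measurableT_comp; first exact: continuous_measurable_fun (@continuous_cos R).
    apply: measurable_funM; last exact: measurable_snd.
    by apply: measurable_funB => //; exact: measurable_fst.
  - move=> z; apply: mulr_ge0; first exact: expR_ge0.
    by have := cos_geN1 ((z.1 - y) * z.2); lra.
  - by move=> x; rewrite /k/=; exact: (laplace_one_plus_cos (x - y) e0).
  - move=> t _; rewrite (EFin_Rintegral (hk f t df).1) (EFin_Rintegral (hk g t dg).1).
    by rewrite -!/(expect _ _) (hk f t df).2 (hk g t dg).2 eq_chf_cos.
(* Both densities have mass 1, so the constant [e^-1] contributes equally to the two sides and drops
   out. *)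
rewrite !expectD; first by rewrite !expect_cst// => /addrI.
- exact: has_expect_cst.
- exact: has_expect_cauchy.
- exact: has_expect_cst.
- exact: has_expect_cauchy.
Qed.

Let expect_atan (e a b : R) : 0 < e -> a < b ->
  expect f (fun x => atan (e^-1 * (b - x)) - atan (e^-1 * (a - x))) =
  expect g (fun x => atan (e^-1 * (b - x)) - atan (e^-1 * (a - x))).
Proof.
move=> e0 ab.
apply: (@eq_integral_mixture _ f g `[a, b]%classic
  (fun z => e / (e ^+ 2 + (z.1 - z.2) ^+ 2))) => //.
- apply: measurable_cauchy_kernel => //; apply: measurable_funB.
    exact: measurable_fst.
  exact: measurable_snd.
- by move=> z; have /andP[] := cauchy_kernel_bounds z.1 z.2 e0.
- by move=> x; exact: integral_cauchy_kernel.
- move=> t _; rewrite (EFin_Rintegral (has_expect_cauchy t df e0)).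
  rewrite (EFin_Rintegral (has_expect_cauchy t dg e0)).
  by rewrite -!/(expect _ _) expect_cauchy.
Qed.

Lemma cvg_atan_mulrn (c : R) :
  atan (n.+1%:R * c) @[n --> \oo] --> pi / 2 * Num.sg c.
Proof.
have pos (d : R) : 0 < d -> atan (n.+1%:R * d) @[n --> \oo] --> pi / 2.
  move=> d0; apply: (@cvg_comp _ _ _ (fun n : nat => n.+1%:R * d) atan _ (pinfty_nbhs R)).
    apply/cvgryPge => A; near=> n.
    rewrite -ler_pdivrMr//; near: n.
    exists (truncn `|A / d|).+1 => //= n /= hn.
    apply: (le_trans (ler_norm _)); apply: ltW.
    apply: (lt_le_trans (truncnS_gt _)).
    by rewrite ler_nat; apply: (leq_trans hn); exact: leqnSn.
  exact: cvgy_atan.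
have [c0|c0|->] := ltgtP c 0.
- rewrite ltr0_sg// mulrN1.
  rewrite (_ : (fun n => _) = (fun n : nat => - atan (n.+1%:R * - c))); last first.
    by apply/funext => n; rewrite mulrN atanN opprK.
  by apply: cvgN; apply: pos; rewrite oppr_gt0.
- by rewrite gtr0_sg// mulr1; exact: pos.
- rewrite sgr0 mulr0.
  by under eq_fun do rewrite mulr0 atan0; exact: cvg_cst.
Unshelve. all: by end_near. Qed.

Lemma cvg_atan_sqr (c : R) :
  atan (n.+1%:R * (c - n.+1%:R)) @[n --> \oo] --> - (pi / 2).
Proof.
rewrite (_ : (fun n => _) = (fun n : nat => - atan (n.+1%:R * (n.+1%:R - c)))); last first.
  by apply/funext => n; rewrite -atanN -mulrN opprB.
apply: cvgN.
apply: (@cvg_comp _ _ _ (fun n : nat => n.+1%:R * (n.+1%:R - c)) atan _ (pinfty_nbhs R)).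
  apply/cvgryPge => A; near=> n.
  have h1 : `|A| <= n.+1%:R - c.
    near: n; exists (truncn (`|A| + `|c|)).+1 => //= n /= hn.
    rewrite lerBrDr; apply: (le_trans (lerD (lexx _) (ler_norm c))); apply: ltW.
    apply: (lt_le_trans (truncnS_gt _)).
    by rewrite ler_nat; apply: (leq_trans hn); exact: leqnSn.
  apply: (le_trans (ler_norm A)); apply: (le_trans h1).
  by rewrite ler_peMl ?(le_trans _ h1)// ler1n.
exact: cvgy_atan.
Unshelve. all: by end_near. Qed.

(** This is pi for x < b, 0 for x > b and pi / 2 at [b]: pi times the indicator of the half-line, up
    to one point. *)
Let step (b x : R) := pi / 2 * Num.sg (b - x) + pi / 2.

(** The Poisson kernel of width 1/(n+1) integrated over centres from b - (n+1) to b. One index both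
    narrows the kernel and pushes the lower end to minus infinity. *)
Let sweep (b : R) (n : nat) (x : R) :=
  atan (n.+1%:R * (b - x)) - atan (n.+1%:R * (b - n.+1%:R - x)).

Let measurable_sweep b n : measurable_fun setT (sweep b n).
Proof.
have matan : measurable_fun [set: R] (@atan R).
  by apply: continuous_measurable_fun => x; exact: continuous_atan.
by apply: measurable_funB; apply: (measurableT_comp matan);
  apply: measurable_funM => //; exact: measurable_funB.
Qed.

Let cvg_sweep b x : sweep b n x @[n --> \oo] --> step b x.
Proof.
rewrite /step -[X in _ + X]opprK; apply: cvgB; first exact: cvg_atan_mulrn.
by under eq_fun do rewrite addrAC; exact: cvg_atan_sqr.
Qed.

Let measurable_step b : measurable_fun setT (step b).
Proof.
apply: (@measurable_fun_cvg _ _ _ setT (sweep b)) => [|x _].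
  exact: measurable_sweep.
exact: cvg_sweep.
Qed.

Let expect_step b : expect f (step b) = expect g (step b).
Proof.
have cu h : is_density h -> expect h (sweep b n) @[n --> \oo] --> expect h (step b).
  (* Dominated convergence with the bound pi: each arctangent is at most pi / 2 in absolute
     value. *)
  move=> dh; apply: (@expect_cvg _ h (sweep b) (step b) pi) => // n x.
  rewrite /sweep ler_norml; set p := atan _; set q := atan _.
  have := atan_ltpi2 (n.+1%:R * (b - x)); have := atan_gtNpi2 (n.+1%:R * (b - x)).
  have := atan_ltpi2 (n.+1%:R * (b - n.+1%:R - x)).
  have := atan_gtNpi2 (n.+1%:R * (b - n.+1%:R - x)).
  by rewrite -/p -/q => ? ? ? ?; apply/andP; split; lra.
apply: (cvg_unique _ (cu _ df)) => //.
have -> : (fun n => expect f (sweep b n)) = (fun n => expect g (sweep b n)).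
  apply/funext => n; have n0 : 0 < (n.+1%:R : R)^-1 by rewrite invr_gt0.
  have bn : b - n.+1%:R < b by rewrite ltrBlDr ltrDl.
  by have := expect_atan n0 bn; rewrite invrK.
exact: cu.
Qed.

Lemma expect_stepE h b : is_density h ->
  expect h (step b) = pi * \int[mu]_(x in `]-oo, b]) h x.
Proof.
move=> dh; have [h0 mh _] := dh; have ih := density_integrable dh.
rewrite Rintegral_mkcond -RintegralZl//; last first.
  by rewrite -restrict_EFin; apply/(integrable_mkcond _ _).1 => //; exact: integrableS ih.
congr fine; apply: ae_eq_integral => //.
- by apply/measurable_EFinP; apply: measurable_funM => //; exact: measurable_step.
- apply/measurable_EFinP; apply: measurable_funM => //.
  by apply/(measurable_restrictT _ _).1 => //; exact: measurable_funTS.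
exists [set b]; split; [exact: measurable_set1|exact: lebesgue_measure_set1|].
move=> x /= /not_implyP[_ hx]; apply/eqP/negPn/negP => xb; apply: hx; congr EFin.
rewrite /step patchE; have [bx|bx|bx] := ltgtP b x.
- rewrite memNset; last by rewrite /= in_itv/= leNgt bx.
  by rewrite ltr0_sg ?subr_lt0// mulrN1 addNr !mulr0.
- rewrite mem_set; last by rewrite /= in_itv/= ltW.
  by rewrite gtr0_sg ?subr_gt0//; field.
- by rewrite bx eqxx in xb.
Qed.

(* The Laplace transform in [t] turns the equality of characteristic functions
   into one of Poisson integrals; integrating the kernel of width [1 / n] over
   [b - n <= y <= b] and letting [n] tend to infinity gives the indicator of a
   half-line, so the distribution functions agree. *)
Theorem chf_injective : {ae mu, forall x, f x = g x}.
Proof.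
pose cdf (h : R -> R) (b : R) : R := \int[mu]_(x in `]-oo, b]) h x.
have eqF : cdf f = cdf g.
  apply/funext => b; have := expect_step b; rewrite !expect_stepE//.
  by move=> /mulfI; apply; rewrite gt_eqF// pi_gt0.
(* A density is recovered almost everywhere as the derivative of its distribution function. *)
have ftc h : is_density h ->
    {ae mu, forall x, derivable (cdf h) x 1 /\ (cdf h)^`()%classic x = h x}.
  move=> dh; have ih := density_integrable dh; apply: FTC1Ny.
    by move=> y; exact: integrableS ih.
  by apply: open_integrable_locally => //; exact: openT.
have := ftc g dg; have := ftc f df; rewrite eqF.
apply: filterS2; first exact: (ae_filter_ringOfSetsType mu).
by move=> x [_ <-] [_ <-].
Qed.

End fourier_uniqueness.

(** * Doubling constant *)
Section doubling_constant.
Context {R : realType}.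
Notation mu := (@lebesgue_measure R).
Implicit Types f : R -> R.

Lemma has_expect_id f : is_density f -> finite_variance f -> has_expect f id.
Proof.
move=> df hv; have h2 : has_expect f (fun x => x ^+ 2).
  by apply: eq_integrable hv => // x _ /=; rewrite mulrC.
have := has_expectD (has_expect_cst df 1) h2.
apply: has_expect_dominated => //.
move=> x; rewrite [leRHS]ger0_norm ?addr_ge0 ?sqr_ge0// ler_norml.
have := sqr_ge0 (x + 1); have := sqr_ge0 (x - 1); rewrite !expr2 => h3 h4.
by apply/andP; split; nra.
Qed.

Lemma dmeanE f : dmean f = expect f id.
Proof. by apply: eq_Rintegral => x _; rewrite mulrC. Qed.

Lemma dvarianceE f : dvariance f = expect f (fun x => (x - dmean f) ^+ 2).
Proof. by apply: eq_Rintegral => x _; rewrite mulrC. Qed.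

Lemma has_expect_centered f c : is_density f -> finite_variance f ->
  has_expect f (fun x => x - c).
Proof.
move=> df hv; apply: has_expectB; first exact: has_expect_id.
exact: has_expect_cst.
Qed.

Lemma expect_centered f : is_density f -> finite_variance f ->
  expect f (fun x => x - dmean f) = 0.
Proof.
move=> df hv; rewrite expectB; first by rewrite expect_cst// dmeanE subrr.
  exact: has_expect_id.
exact: has_expect_cst.
Qed.

Lemma has_expect_centered_sqr f c : is_density f -> finite_variance f ->
  has_expect f (fun x => (x - c) ^+ 2).
Proof.
move=> df hv; have h2 : has_expect f (fun x => x ^+ 2).
  by apply: eq_integrable hv => // x _ /=; rewrite mulrC.
have := has_expectB h2 (has_expectZ (c *+ 2) (has_expect_id df hv)).
move=> /has_expectD /(_ (has_expect_cst df (c ^+ 2))).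
by apply: eq_has_expect => x; ring.
Qed.

(** With zero variance [f] would vanish almost everywhere off its mean; a point is a null set, so
    the total mass would be 0. *)
Lemma dvariance_gt0 f : is_density f -> finite_variance f -> 0 < dvariance f.
Proof.
move=> df hv; have [f0 mf f1] := df; have hq := has_expect_centered_sqr (dmean f) df hv.
rewrite dvarianceE; set F := fun x => (x - dmean f) ^+ 2.
pose G x := f x * F x; have G0 x : 0 <= G x by rewrite mulr_ge0 ?sqr_ge0.
have v_ge0 : 0 <= expect f F by apply: Rintegral_ge0 => x _; exact: G0.
rewrite lt_neqAle v_ge0 andbT; apply/negP => /eqP v0.
have [+ _] := ae_eq_integral_abs mu measurableT
  (measurable_int _ hq : measurable_fun setT (EFin \o G)).
have -> : (\int[mu]_x `|(EFin \o G) x| = \int[mu]_x (G x)%:E)%E.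
  by apply: eq_integral => x _; rewrite /= ger0_norm.
rewrite (EFin_Rintegral hq) -/(expect f F) -v0 => /(_ erefl) ae0.
have : (\int[mu]_x (f x)%:E = \int[mu]_x (cst 0%E x))%E.
  apply: ae_eq_integral => //; first exact/measurable_EFinP.
  have : {ae mu, forall x, x != dmean f}.
    exists [set dmean f]; split; [exact: measurable_set1|exact: lebesgue_measure_set1|].
    by move=> x /= /negP; rewrite negbK => /eqP.
  move: ae0; apply: filterS2 => x /(_ I)/= [/eqP] + xm _; rewrite mulf_eq0 => /orP[/eqP->//|].
  by rewrite /F sqrf_eq0 subr_eq0 (negbTE xm).
by rewrite f1 integral0 => /eqP; rewrite onee_eq0.
Qed.

Lemma dconv_second_moment f : is_density f -> finite_variance f ->
  has_expect (dconv f f) (fun x => (x - dmean f *+ 2) ^+ 2) /\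
  expect (dconv f f) (fun x => (x - dmean f *+ 2) ^+ 2) = dvariance f *+ 2.
Proof.
move=> df hv; set m := dmean f; set v := dvariance f.
have h1 := has_expect_centered m df hv; have h2 := has_expect_centered_sqr m df hv.
have e1 : expect f (fun x => x - m) = 0 := expect_centered df hv.
have e2 : expect f (fun x => (x - m) ^+ 2) = v by rewrite -dvarianceE.
(* The square is expanded about the common mean, so the cross term integrates to 0 and the variances
   add. *)
pose k y z := ((y - m) ^+ 2 + (y - m) *+ 2 * (z - m)) + (z - m) ^+ 2.
have kE y z : (y + z - m *+ 2) ^+ 2 = k y z by rewrite /k; ring.
have hc c := has_expect_cst df c.
have hk y : has_expect f (fun z => (y - m) ^+ 2 + (y - m) *+ 2 * (z - m)).
  by apply: has_expectD (hc _) _; exact: has_expectZ.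
have ek y : expect f (fun z => (y - m) ^+ 2 + (y - m) *+ 2 * (z - m)) = (y - m) ^+ 2.
  rewrite (expectD (hc _) (has_expectZ _ h1)) (expectZ _ h1) e1 mulr0 addr0.
  exact: expect_cst.
have := @expect_dconv _ f df (fun x => (x - m *+ 2) ^+ 2) (fun y => (y - m) ^+ 2 + v).
case.
- by apply: measurable_funX; exact: measurable_funB.
- by move=> x; exact: sqr_ge0.
- by move=> y; apply: eq_has_expect (has_expectD (hk y) h2) => z; rewrite kE.
- by move=> y; rewrite (eq_expect _ (kE y)) (expectD (hk y) h2) ek e2.
- exact: has_expectD.
move=> hg eg; split => //; rewrite /expect eg expectD// expect_cst// e2.
by rewrite mulr2n.
Qed.

(** The term [2^-1] is the variance divided by twice itself, the reference Gaussian having the same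
    moments. *)
Lemma rel_entropy_gauss_match f : is_density f -> finite_variance f ->
  entropy_exists f ->
  rel_entropy f (gauss_match f) =
  2^-1 - ln (normal_peak (Num.sqrt (dvariance f))) - diff_entropy f.
Proof.
move=> df hv he; have [f0 mf f1] := df; have v0 := dvariance_gt0 df hv.
rewrite /rel_entropy /gauss_match; set m := dmean f; set s := Num.sqrt _.
have s0 : 0 < s by rewrite sqrtr_gt0.
have s2 : s ^+ 2 = dvariance f by rewrite sqr_sqrtr// ltW.
have h2 := has_expect_centered_sqr m df hv.
pose p := ln (normal_peak s).
have iA := integrableZl_EFin (s ^+ 2 *+ 2)^-1 h2.
have iB := integrableZl_EFin p (density_integrable df).
transitivity (\int[mu]_x ((f x * ln (f x) +
    (s ^+ 2 *+ 2)^-1 * (f x * (x - m) ^+ 2)) - p * f x)).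
  (* Where [f] vanishes the logarithm of the quotient does not split, but every term carries the
     factor [f x]. *)
  apply: eq_Rintegral => x _; have := f0 x; rewrite le_eqVlt => /predU1P[<-|fx0].
    by rewrite !mul0r !mulr0 subr0 addr0.
  rewrite ln_div ?posrE ?normal_pdf_gt0// ln_normal_pdf// -/p; ring.
rewrite RintegralB//; last exact: (integrableD_EFin he iA).
rewrite RintegralD// !RintegralZl//; last exact: density_integrable.
have -> : \int[mu]_x (f x * (x - m) ^+ 2) = s ^+ 2 by rewrite s2 dvarianceE.
rewrite /diff_entropy -/p.
have -> : \int[mu]_x f x = 1 by rewrite /Rintegral f1.
by field; rewrite gt_eqF.
Qed.

(** Each value of a convolution is an integral, so an almost everywhere hypothesis gives equality at
    every point. The two factors are replaced one at a time, the reflection y -> x - y exchanging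
    their roles. *)
Lemma dconv_ae_normal f m s : is_density f -> 0 < s ->
  {ae mu, forall x, f x = normal_pdf m s x} ->
  dconv f f = normal_pdf (m *+ 2) (Num.sqrt 2 * s).
Proof.
move=> df s0 fN; rewrite -dconv_normal//; apply/funext => x.
have [_ mf _] := df; have mN := measurable_normal_pdf m s.
have mr (h : R -> R) : measurable_fun setT h -> measurable_fun setT (fun y : R => h (x - y)).
  by move=> mh; apply: (measurableT_comp mh); exact: measurable_funB.
transitivity (\int[mu]_y (normal_pdf m s y * f (x - y))).
  by apply: (ae_eq_expect mf mN) fN; exact: mr.
transitivity (\int[mu]_y (f y * normal_pdf m s (x - y))).
  congr fine; rewrite -[LHS](integral_reflect x).
    by apply: eq_integral => y _; rewrite subKr mulrC.
  by apply/measurable_EFinP/measurable_funM => //; exact: mr.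
by apply: (ae_eq_expect mf mN) fN; exact: mr.
Qed.

(** Needed because the theorem asks for some Gaussian, while [gauss_match] fixes its parameters by
    the moments of [f]. *)
Lemma mean_variance_ae_normal f m s : is_density f -> finite_variance f -> 0 < s ->
  {ae mu, forall x, f x = normal_pdf m s x} -> dmean f = m /\ dvariance f = s ^+ 2.
Proof.
move=> df hv s0 fN; have [_ mf _] := df; have mN := measurable_normal_pdf m s.
have mE : dmean f = m.
  apply/eqP; rewrite -subr_eq0; apply/eqP.
  rewrite -(expect_normal_centered m s0) -(ae_eq_expect mf mN _ fN); last first.
    exact: measurable_funB.
  rewrite expectB; first by rewrite expect_cst// dmeanE.
    exact: has_expect_id.
  exact: has_expect_cst.
split => //; rewrite dvarianceE mE -(expect_normal_sqr m s0).
apply: (ae_eq_expect mf mN _ fN).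
by apply: measurable_funX; exact: measurable_funB.
Qed.

End doubling_constant.

Theorem mainTheorem18 (R : realType) (f : R -> R) :
  is_density f ->
  finite_variance f ->
  entropy_exists f ->
  entropy_exists (dconv f f) ->
  doubling f <= Num.sqrt 2 * expR (rel_entropy f (gauss_match f)) /\
  (doubling f = Num.sqrt 2 * expR (rel_entropy f (gauss_match f)) <->
   exists m s : R, 0 < s /\
     {ae (@lebesgue_measure R), forall x, f x = normal_pdf m s x}).
Proof.
move=> df hv hef heg; have v0 := dvariance_gt0 df hv.
pose m := dmean f; pose s := Num.sqrt (dvariance f).
have s0 : 0 < s by rewrite sqrtr_gt0.
have s2 : s ^+ 2 = dvariance f by rewrite sqr_sqrtr// ltW.
have r0 : 0 < Num.sqrt 2 :> R by rewrite sqrtr_gt0.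
have r2 : Num.sqrt 2 ^+ 2 = 2 :> R by rewrite sqr_sqrtr.
have [hg eg] := dconv_second_moment df hv.
have [D0 Deq] := gibbs_normal (is_density_dconv df df) (mulr_gt0 r0 s0) hg heg.
move: D0 Deq; set D := (X in 0 <= X) => D0 Deq.
(* In logarithms: the two terms 1/2 agree, ln (sqrt 2) is the difference of the log-peaks, and the
   entropy of the convolution cancels between [doubling f] and [D]. *)
have -> : Num.sqrt 2 * expR (rel_entropy f (gauss_match f)) = doubling f * expR D.
  rewrite /doubling -expRD -[in LHS](lnK (_ : Num.sqrt 2 \in Num.pos)) ?posrE//.
  rewrite -expRD; congr expR; rewrite rel_entropy_gauss_match// -/s /D eg.
  rewrite normal_peakM// ln_div ?posrE ?normal_peak_gt0 ?gt_eqF//.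
  by rewrite exprMn r2 s2; field; rewrite gt_eqF.
have d0 : 0 < doubling f by exact: expR_gt0.
have e1 : 1 <= expR D by rewrite -[leLHS]expR0 ler_expR.
split; first by apply: ler_peMr => //; exact: ltW.
have DE : doubling f = doubling f * expR D <-> D = 0.
  split => [h|->]; last by rewrite expR0 mulr1.
  have /mulfI : doubling f != 0 by rewrite gt_eqF.
  move=> /(_ 1 (expR D)); rewrite mulr1 => /(_ h) h1.
  by rewrite -(expRK D) -h1 ln1.
rewrite DE Deq; split => [gN|[m' [s' [s'0 fN]]]].
  exists m, s; split => //; have chf := chf_of_normal_dconv df s0 gN.
  apply: (chf_injective df (is_density_normal_pdf m s)) => t.
    exact: (chf t).1.
  exact: (chf t).2.
have [mE vE] := mean_variance_ae_normal df hv s'0 fN.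
apply: aeW => x; rewrite (dconv_ae_normal df s'0 fN) /m mE /s vE.
by rewrite sqrtr_sqr gtr0_norm.
Qed.
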